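(* Let $D_1$ and $D_2$ be digraphs, each with at least $2$ vertices, both having the tournament Sidorenko property, and let $v^*\in V(D_1)$ be a vertex such that $D_1[V(D_1)\setminus\{v^*\}]$ is tournament anti-Sidorenko. Then the digraph obtained by substituting $D_2$ for $v^*$ in $D_1$ has the tournament Sidorenko property.
   Context: All digraphs are oriented graphs (no loops, no antiparallel edges). A tournament is an orientation of a complete graph without loops. $t_D(T)=h_D(T)/v(T)^{v(D)}$ where $h_D(T)$ is the number of maps $\phi:V(D)\to V(T)$ with $(\phi(x),\phi(y))\in E(T)$ for every $(x,y)\in E(D)$. $D$ is tournament Sidorenko if $t_D(T)\ge(1-o(1))2^{-e(D)}$ for every tournament $T$ (with $o(1)\to0$ as $v(T)\to\infty$), and tournament anti-Sidorenko if $t_D(T)\le 2^{-e(D)}$ for every tournament $T$. For digraphs $D_1,D_2$ and $v^*\in V(D_1)$, substituting $D_2$ for $v^*$ gives the digraph with vertex set $(V(D_1)\setminus\{v^*\})\sqcup V(D_2)$ whose edges are: the edges of $D_1$ between vertices of $V(D_1)\setminus\{v^*\}$; the edges of $D_2$; for $u\in V(D_1)\setminus\{v^*\}$ and $w\in V(D_2)$, the edge $(u,w)$ if $(u,v^* )\in E(D_1)$ and the edge $(w,u)$ if $(v^*,u)\in E(D_1)$. $D[S]$ denotes the induced subdigraph on $S$. *)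

(* Defs.v *)
From HB Require Import structures.
From mathcomp Require Import all_boot all_order all_algebra.
Set Implicit Arguments.
Unset Strict Implicit.
Unset Printing Implicit Defensive.
Import Order.TTheory GRing.Theory Num.Theory.
Local Open Scope ring_scope.

(* Taking [y := x] in [edge_oriented] also excludes loops. *)
Record digraph := Digraph {
  vertex :> finType;
  edge : rel vertex;
  edge_oriented : forall x y, edge x y -> ~~ edge y x
}.

Definition nb_vertices (D : digraph) : nat := #|D|.

Definition nb_edges (D : digraph) : nat :=
  #|[set p : D * D | edge p.1 p.2]|.

Definition tournament (T : digraph) : Prop :=
  forall x y : T, x != y -> edge x y || edge y x.

Definition is_hom (D T : digraph) (f : {ffun D -> T}) : bool :=
  [forall x, forall y, edge x y ==> edge (f x) (f y)].

Definition nb_homs (D T : digraph) : nat :=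
  #|[set f : {ffun D -> T} | is_hom f]|.

(* If [T] has no vertex and [D] has at least one, this is 0 / 0 = 0; such [T]
   affects neither of the two properties below. *)
Definition hom_density (D T : digraph) : rat :=
  (nb_homs D T)%:R / (nb_vertices T)%:R ^+ nb_vertices D.

(* Densities are rational, so rational [eps] suffice to express the o(1). *)
Definition tournament_sidorenko (D : digraph) : Prop :=
  forall eps : rat, 0 < eps ->
  exists N : nat, forall T : digraph, tournament T -> (N <= nb_vertices T)%N ->
    (1 - eps) * 2^-1 ^+ nb_edges D <= hom_density D T.

Definition tournament_anti_sidorenko (D : digraph) : Prop :=
  forall T : digraph, tournament T -> hom_density D T <= 2^-1 ^+ nb_edges D.

Section Induced.
Variables (D : digraph) (S : {set D}).

Definition induced_edge : rel {x : D | x \in S} :=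
  fun x y => edge (val x) (val y).

Lemma induced_edge_oriented x y : induced_edge x y -> ~~ induced_edge y x.
Proof. exact: edge_oriented. Qed.

Definition induced : digraph := Digraph induced_edge_oriented.
End Induced.

Section Substitution.
Variables (D1 D2 : digraph) (v : D1).

Definition substitution_edge : rel ({x : D1 | x \in [set~ v]} + D2)%type :=
  fun a b => match a, b with
  | inl x, inl y => edge (val x) (val y)
  | inl x, inr _ => edge (val x) v
  | inr _, inl y => edge v (val y)
  | inr w, inr z => edge w z
  end.

Lemma substitution_edge_oriented a b :
  substitution_edge a b -> ~~ substitution_edge b a.
Proof. by case: a b => [x|w] [y|z] /=; apply: edge_oriented. Qed.

Definition substitution : digraph := Digraph substitution_edge_oriented.
End Substitution.

Arguments induced : clear implicits.
Arguments substitution : clear implicits.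

(* Main.v *)
(** Write [D := D1 - v], [k := v(D2)], [d := deg v], [n := v(T)].  A homomorphism
    [phi : D -> T] has a set [A] of admissible images of [v]; extending [phi] to
    the substitution amounts to choosing a homomorphism of [D2] into the
    tournament [T[A]], and there are about [2^-e(D2) |A|^k] or more of these
    unless [A] is bounded.  The sizes [|A|] sum to [h_{D1}(T)], which is bounded
    below, while the number of [phi] is bounded above by anti-Sidorenko; so the
    average of [|A|] is at least about [c := 2^-d n], and convexity of the [k]-th
    power bounds the sum of the [|A|^k].  Convexity is used as the tangent line
    inequality at [c], which is linear in both counts. *)

Require Import Defs.
From mathcomp Require Import all_boot all_order all_algebra.
From mathcomp Require Import ring lra.
Set Implicit Arguments.
Unset Strict Implicit.
Unset Printing Implicit Defensive.
Import Order.TTheory GRing.Theory Num.Theory.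

(** * Edge counts under deletion and substitution of a vertex *)

Lemma big_setC1_sub (R : Type) (idx : R) (op : Monoid.com_law idx)
    (I : finType) (i0 : I) (F : I -> R) :
  \big[op/idx]_(i : I) F i =
  op (F i0) (\big[op/idx]_(j : {i : I | i \in [set~ i0]}) F (val j)).
Proof.
rewrite (bigD1 i0) //= -(big_sub (mem [set~ i0])) /=.
by congr (op _ _); apply: eq_bigl => i; rewrite !inE.
Qed.

Lemma nb_edgesE (D : digraph) : nb_edges D = \sum_x \sum_y edge (d := D) x y.
Proof.
rewrite /nb_edges -sum1dep_card big_mkcond pair_big /=.
by apply: eq_bigr => p _; case: edge.
Qed.

Lemma edge_irrefl (D : digraph) (x : D) : edge x x = false.
Proof. by apply/negbTE/negP => e; have := edge_oriented e; rewrite e. Qed.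

Section Counting.
Variables (D1 D2 : digraph) (v : D1).
Local Notation S := {x : D1 | x \in [set~ v]}.

Definition degree : nat := \sum_(x : S) (edge (val x) v + edge v (val x)).

Lemma nb_edges_delete :
  nb_edges D1 = nb_edges (induced D1 [set~ v]) + degree.
Proof.
rewrite !nb_edgesE (big_setC1_sub _ v) (big_setC1_sub _ v) edge_irrefl /= add0n.
under [X in _ + X]eq_bigr => x _ do rewrite (big_setC1_sub _ v).
rewrite big_split /degree big_split /= addnA addnC; congr (_ + _).
by rewrite addnC.
Qed.

(** Every edge at [v] turns into one edge for each vertex of [D2]. *)
Lemma nb_edges_substitution :
  nb_edges (substitution D1 D2 v) =
  nb_edges (induced D1 [set~ v]) + nb_edges D2 + nb_vertices D2 * degree.
Proof.
rewrite !nb_edgesE big_sumType /=.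
under eq_bigr => x _ do rewrite big_sumType /= sum_nat_const.
under [X in _ + X]eq_bigr => x _ do rewrite big_sumType /=.
rewrite !big_split /= sum_nat_const -big_distrr /=.
rewrite /degree big_split mulnDr /= -!addnA; congr (_ + _).
by rewrite addnA addnC.
Qed.

(** * Homomorphisms fibred over their restriction to [D1 - v] *)

Section Homs.
Variable T : digraph.
Local Notation hom := {ffun S -> T}.

Definition extension (phi : hom) : {set T} :=
  [set w | [forall x, (edge (val x) v ==> edge (phi x) w) &&
                      (edge v (val x) ==> edge w (phi x))]].

(** Homomorphisms with the same restriction [phi] differ only at [v], so evaluation at [v] embeds
    each fibre into [extension phi]. *)
Lemma nb_homs_delete :
  nb_homs D1 T <= \sum_(phi : hom | @is_hom (induced D1 [set~ v]) T phi)
                   #|extension phi|.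
Proof.
pose r (f : {ffun D1 -> T}) : hom := [ffun x => f (val x)].
rewrite /nb_homs -sum1dep_card.
rewrite (partition_big r (@is_hom (induced D1 [set~ v]) T)) /=; last first.
  move=> f /forallP hf; apply/forallP => x; apply/forallP => y.
  by rewrite !ffunE; have /forallP := hf (val x); exact.
apply: leq_sum => phi _; rewrite sum1dep_card.
rewrite -(card_in_imset (f := fun f : {ffun D1 -> T} => f v)).
  apply: subset_leq_card; apply/subsetP => _ /imsetP [f + ->].
  rewrite !inE => /andP [/forallP hf /eqP <-]; apply/forallP => x.
  rewrite ffunE; have /forallP /(_ v) -> := hf (val x).
  by have /forallP /(_ (val x)) -> := hf v.
move=> f g; rewrite !inE => /andP [_ /eqP fphi] /andP [_ /eqP gphi] fgv.
apply/ffunP => x; have [-> //|xv] := eqVneq x v.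
have xS : x \in [set~ v] by rewrite !inE.
have := congr1 (fun h : hom => h (Sub x xS)) (etrans fphi (esym gphi)).
by rewrite !ffunE.
Qed.

(** Gluing [phi] to a homomorphism of [D2] into [extension phi] is injective for fixed [phi], and
    the edges between the two parts are preserved by the choice of [extension phi]. *)
Lemma nb_homs_substitution :
  \sum_(phi : hom | @is_hom (induced D1 [set~ v]) T phi)
    nb_homs D2 (induced T (extension phi)) <=
  nb_homs (substitution D1 D2 v) T.
Proof.
pose r (f : {ffun S + D2 -> T}) : hom := [ffun x => f (inl x)].
rewrite [X in _ <= X]/nb_homs -sum1dep_card.
rewrite (partition_big r (@is_hom (induced D1 [set~ v]) T)) /=; last first.
  move=> f /forallP hf; apply/forallP => x; apply/forallP => y.
  by rewrite !ffunE; have /forallP := hf (inl x) => /(_ (inl y)).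
apply: leq_sum => phi phi_hom; rewrite sum1dep_card /nb_homs.
pose glue (g : {ffun D2 -> induced T (extension phi)}) : {ffun S + D2 -> T} :=
  [ffun a => match a with inl x => phi x | inr w => val (g w) end].
rewrite -(card_in_imset (f := glue)); last first.
  move=> g h _ _ /ffunP gh; apply/ffunP => w; apply: val_inj.
  by have := gh (inr w); rewrite !ffunE.
apply: subset_leq_card; apply/subsetP => _ /imsetP [g + ->].
rewrite !inE => /forallP g_hom; apply/andP; split; last first.
  by apply/eqP/ffunP => x; rewrite !ffunE.
have ext x w : (edge (val x) v ==> edge (phi x) (val (g w))) &&
               (edge v (val x) ==> edge (val (g w)) (phi x)).
  by have := valP (g w); rewrite inE => /forallP.
apply/forallP => -[x|w]; apply/forallP => -[y|z]; rewrite !ffunE /=.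
- by have /forallP /(_ x) /forallP := phi_hom; exact.
- by have /andP [] := ext x z.
- by have /andP [] := ext y w.
- by have /forallP := g_hom w; exact.
Qed.

End Homs.

End Counting.

Lemma card_induced (T : digraph) (A : {set T}) :
  nb_vertices (induced T A) = #|A|.
Proof. by rewrite /nb_vertices card_sig; apply: eq_card. Qed.

Lemma tournament_induced (T : digraph) (A : {set T}) :
  tournament T -> tournament (induced T A).
Proof. by move=> hT x y xy; apply: hT; rewrite (inj_eq val_inj). Qed.

Local Open Scope ring_scope.

Lemma hom_density_ge0 (D T : digraph) : 0 <= hom_density D T.
Proof. by rewrite divr_ge0 ?exprn_ge0. Qed.

(* The induction step multiplies by [a] and adds [k.+1 * c ^+ k * (a - c) ^+ 2]. *)
Lemma tangent_power (R : realFieldType) (k : nat) (a c : R) :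
  0 <= a -> 0 <= c -> k.+1%:R * a * c ^+ k <= a ^+ k.+1 + k%:R * c ^+ k.+1.
Proof.
move=> a0 c0; elim: k => [|k IH]; first by rewrite mul0r addr0 mul1r expr0 mulr1.
have ck0 : 0 <= c ^+ k by rewrite exprn_ge0.
have k0 : 0 <= k.+1%:R :> R by [].
have := ler_wpM2l a0 IH.
have := mulr_ge0 (mulr_ge0 k0 ck0) (sqr_ge0 (a - c)).
rewrite -[k.+2%:R]natr1 -[k.+1%:R]natr1 !exprS.
nra.
Qed.


(** Sum the tangent inequality at [c] over [P]. The cardinality of [P] enters with a negative sign,
    so its upper bound [q] suffices, and [k * (1 - delta) - (k - 1) = 1 - k * delta]. *)
Lemma power_sum_lower (R : realFieldType) (I : finType) (P : pred I)
    (a : I -> R) (k : nat) (c q delta : R) :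
  (0 < k)%N -> (forall i, 0 <= a i) -> 0 <= c -> #|[set i | P i]|%:R <= q ->
  (1 - delta) * q * c <= \sum_(i | P i) a i ->
  (1 - k%:R * delta) * q * c ^+ k <= \sum_(i | P i) a i ^+ k.
Proof.
case: k => // k _ a0 c0 Pq sum_a.
have : \sum_(i | P i) (k.+1%:R * a i * c ^+ k) <=
       \sum_(i | P i) (a i ^+ k.+1 + k%:R * c ^+ k.+1).
  by apply: ler_sum => i _; apply: tangent_power.
rewrite -mulr_suml -mulr_sumr big_split /= sumr_const -[#|P|]cardsE -mulr_natl.
have k0 : 0 <= k%:R :> R by [].
have := ler_wpM2r (mulr_ge0 k0 (exprn_ge0 k.+1 c0)) Pq.
have := ler_wpM2l (mulr_ge0 (ler0n R k.+1) (exprn_ge0 k c0)) sum_a.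
rewrite -natr1 !exprS.
set ck := c ^+ k; set s := \sum_(i | P i) a i; set t := \sum_(i | P i) _.
lra.
Qed.

Lemma nb_homs_lower (D T : digraph) (x : rat) :
  (0 < nb_vertices D)%N -> x <= hom_density D T ->
  x * (nb_vertices T)%:R ^+ nb_vertices D <= (nb_homs D T)%:R.
Proof.
(* For empty [T] the density is a division by zero, but [D] has a vertex, so the power on the left
   is 0. *)
rewrite /hom_density => D0; have [->|T0] := posnP (nb_vertices T).
  by rewrite expr0n eqn0Ngt D0 mulr0.
by rewrite ler_pdivlMr // exprn_gt0 // ltr0n.
Qed.

Theorem theorem4p8 (D1 D2 : digraph) (vstar : D1)
    (hD1 : (2 <= nb_vertices D1)%N) (hD2 : (2 <= nb_vertices D2)%N)
    (sD1 : tournament_sidorenko D1) (sD2 : tournament_sidorenko D2)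
    (aD1 : tournament_anti_sidorenko (induced D1 [set~ vstar])) :
  tournament_sidorenko (substitution D1 D2 vstar).
Proof.
move=> eps eps0.
have [eps1|eps1] := ltP 1 eps.
  exists 0%N => T _ _; apply: le_trans (hom_density_ge0 _ _).
  by rewrite pmulr_lle0 ?exprn_gt0 // subr_le0 ltW.
set k := nb_vertices D2 in hD2; have k0 : (0 < k)%N by exact: ltnW.
(* The losses are [k * delta] from convexity, [delta] from the count for [D2] and [delta] from
   bounded extension sets. *)
pose delta : rat := eps / k.+2%:R.
have delta0 : 0 < delta by rewrite divr_gt0 ?ltr0n.
have kdelta : k.+2%:R * delta = eps by rewrite mulrC divfK ?pnatr_eq0.
have delta1 : delta <= 1.
  by rewrite ler_pdivrMr ?ltr0n // mul1r (le_trans eps1) // ler1n.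
have [N1 hN1] := sD1 delta delta0; have [N2 hN2] := sD2 delta delta0.
pose M := (Num.bound delta^-1).+1.
have M1 : 1 <= delta * M%:R.
  rewrite mulrC -ler_pdivrMr // mul1r ltW //.
  apply: (lt_trans (y := (Num.bound delta^-1)%:R)); last by rewrite ltr_nat.
  by rewrite archi_boundP // invr_ge0 ltW.
set d := degree vstar.
(* The second bound gives [N2 * M <= c], and its successor forces [T] to be nonempty. *)
exists (maxn N1 (N2 * 2 ^ d * M).+1)%N => T hT.
rewrite geq_max => /andP [nN1 nN2].
set n : rat := (nb_vertices T)%:R.
have n0 : 0 < n by rewrite ltr0n (leq_ltn_trans _ nN2).
set D := induced D1 [set~ vstar]; set e := nb_edges D; set e2 := nb_edges D2.
set m := nb_vertices D; set h : rat := 2^-1.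
have h0 j : 0 < h ^+ j by rewrite exprn_gt0.
have mS : nb_vertices D1 = m.+1.
  by rewrite /m card_induced cardsC1 /nb_vertices prednK // ltnW.
pose q := h ^+ e * n ^+ m; pose c := h ^+ d * n.
have q0 : 0 < q by rewrite mulr_gt0 // exprn_gt0.
have c0 : 0 < c by rewrite mulr_gt0.
have hq : #|[set phi | @is_hom D T phi]|%:R <= q.
  by have := aD1 T hT; rewrite /hom_density ler_pdivrMr ?exprn_gt0.
pose a (phi : {ffun D -> T}) : rat := #|extension phi|%:R.
have sum_a : (1 - delta) * q * c <= \sum_(phi | @is_hom D T phi) a phi.
  rewrite -natr_sum; apply: (le_trans (y := (nb_homs D1 T)%:R)); last first.
    by rewrite ler_nat nb_homs_delete.
  have := nb_homs_lower (ltnW hD1) (hN1 T hT nN1).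
  rewrite (nb_edges_delete vstar) mS exprD exprS /q /c.
  by apply: le_trans; rewrite le_eqVlt; apply/orP; left; apply/eqP; ring.
have sum_ak := power_sum_lower k0 (fun phi => ler0n _ _) (ltW c0) hq sum_a.
(* This follows from [N2 * M <= c], since [delta * M ^+ k >= delta * M >= 1]. *)
have small : N2%:R ^+ k <= delta * c ^+ k.
  have cM : N2%:R * M%:R <= c.
    rewrite /c /h exprVn [leRHS]mulrC ler_pdivlMr ?exprn_gt0 //.
    by rewrite -natrX -!natrM ler_nat mulnAC ltnW.
  have : (N2%:R * M%:R) ^+ k <= c ^+ k by rewrite lerXn2r ?nnegrE ?mulr_ge0 // ltW.
  move/(ler_wpM2l (ltW delta0)); apply: le_trans.
  rewrite exprMn mulrCA ler_peMr ?exprn_ge0 // (le_trans M1) // ler_wpM2l ?(ltW delta0) //.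
  by rewrite ler_eXnr // ler1n.
(* Subtracting [N2 ^+ k] makes the bound hold for all [phi]: below size [N2], where [hN2] does not
   apply, the left side is nonpositive. *)
have fibre (phi : {ffun D -> T}) :
    (1 - delta) * h ^+ e2 * (a phi ^+ k - N2%:R ^+ k) <=
    (nb_homs D2 (induced T (extension phi)))%:R.
  have x0 : 0 <= (1 - delta) * h ^+ e2 by rewrite mulr_ge0 ?subr_ge0 // ltW.
  have [aN|aN] := leqP N2 #|extension phi|; last first.
    apply: (le_trans (y := 0)) => //; rewrite mulr_ge0_le0 // subr_le0.
    by rewrite lerXn2r ?nnegrE // ler_nat ltnW.
  have := hN2 _ (tournament_induced (A := extension phi) hT).
  rewrite card_induced => /(_ aN) /(nb_homs_lower k0).
  rewrite card_induced; apply: le_trans.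
  by rewrite ler_wpM2l // gerBl exprn_ge0.
have total : (1 - delta) * h ^+ e2 *
    (\sum_(phi | @is_hom D T phi) a phi ^+ k - q * N2%:R ^+ k) <=
    (nb_homs (substitution D1 D2 vstar) T)%:R.
  apply: (le_trans (y := \sum_(phi | @is_hom D T phi)
                  (nb_homs D2 (induced T (extension phi)))%:R)); last first.
    by rewrite -natr_sum ler_nat nb_homs_substitution.
  apply: (le_trans _ (ler_sum _ (fun phi _ => fibre phi))).
  rewrite -mulr_sumr ler_wpM2l ?mulr_ge0 ?subr_ge0 ?(ltW delta0) ?(ltW (h0 _)) //.
  rewrite big_split /= lerD2l sumr_const -[#|_|]cardsE mulNrn lerN2 -[leLHS]mulr_natl.
  by rewrite ler_wpM2r // exprn_ge0.
have vS : nb_vertices (substitution D1 D2 vstar) = (m + k)%N.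
  by rewrite /nb_vertices card_sum.
rewrite /hom_density vS ler_pdivlMr ?exprn_gt0 // nb_edges_substitution.
apply: le_trans total.
rewrite -/D -/e -/e2 -/k -/d -/n -/h.
have -> : (1 - eps) * h ^+ (e + e2 + k * d) * n ^+ (m + k) =
          h ^+ e2 * (q * c ^+ k * (1 - eps)).
  by rewrite /q /c exprMn -exprM mulnC !exprD; ring.
rewrite [(1 - delta) * _]mulrC -[leRHS]mulrA ler_wpM2l ?(ltW (h0 _)) //.
(* The product [(1 - delta) * (1 - (k + 1) * delta)] exceeds [1 - eps] by [(k + 1) * delta ^+ 2]. *)
apply: (le_trans (y := (1 - delta) * (q * c ^+ k * (1 - k.+1%:R * delta)))).
  rewrite mulrCA ler_wpM2l ?mulr_ge0 ?exprn_ge0 ?(ltW q0) ?(ltW c0) // -kdelta -!natr1.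
  have := mulr_ge0 (mulr_ge0 (ltW delta0) (ltW delta0)) (ler0n rat k.+1).
  by rewrite -natr1; lra.
rewrite ler_wpM2l ?subr_ge0 //.
have := ler_wpM2l (ltW q0) small; rewrite -natr1; lra.
Qed.
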